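(* Let $b\ge 2$ and $p\ge1$ be integers, $\alpha>2$ real and $z\ge0$. Then \begin{align*} \sum_{n=1}^{b^{p}-1}\frac{s_{b}(n)}{(n+z)^{\alpha}} =&\sum_{l=0}^{p-1}\left[\zeta_{2}\left(\alpha,z+b^{l},(1,b^{l})\right)-\zeta_{2}\left(\alpha,z+b^{l}+b^{p},(1,b^{l})\right)\right]\\ &-b\sum_{l=1}^{p}\left[\zeta_{2}\left(\alpha,z+b^{l},(1,b^{l})\right)-\zeta_{2}\left(\alpha,z+b^{l}+b^{p},(1,b^{l})\right)\right], \end{align*} and \[ \sum_{n=1}^{+\infty}\frac{s_{b}(n)}{(n+z)^{\alpha}}=-z\zeta(\alpha,z+1)+\zeta(\alpha-1,z+1)+(1-b)\sum_{l=1}^{+\infty}\zeta_{2}\left(\alpha,z+b^{l},(1,b^{l})\right). \]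
   Context: $s_b(n)$ is the sum of the base-$b$ digits of $n$. $\zeta(\alpha,a)=\sum_{n\ge0}(a+n)^{-\alpha}$ is the Hurwitz zeta function. For $x>0$, $a_1,a_2>0$ and $\alpha>2$, the Barnes double zeta function is $\zeta_2(\alpha,x,(a_1,a_2))=\sum_{m_1,m_2\ge0}(x+a_1m_1+a_2m_2)^{-\alpha}$. *)

(* Defs.v *)
From HB Require Import structures.
From mathcomp Require Import all_boot all_order all_algebra.
From mathcomp Require Import all_classical all_reals all_analysis.
Set Implicit Arguments. Unset Strict Implicit. Unset Printing Implicit Defensive.
Import Order.TTheory GRing.Theory Num.Theory.
Import numFieldNormedType.Exports.
Local Open Scope classical_set_scope.
Local Open Scope ring_scope.

Definition digit (b n i : nat) : nat := ((n %/ b ^ i) %% b)%N.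

(* For b >= 2 we have n < b ^ n, so every digit of index i >= n vanishes and
   the sum below ranges over all the base-b digits of n. *)
Definition digit_sum (b n : nat) : nat := (\sum_(i < n) digit b n i)%N.

Lemma digit_eq0 (b n i : nat) : (2 <= b)%N -> (n <= i)%N -> digit b n i = 0%N.
Proof.
move=> b2 ni; rewrite /digit divn_small ?mod0n//.
by rewrite (leq_ltn_trans ni)// ltn_expl.
Qed.

Lemma base_expansion (b n : nat) : (2 <= b)%N ->
  n = (\sum_(i < n) digit b n i * b ^ i)%N.
Proof.
move=> b2.
have H k : (n %/ b ^ k * b ^ k + \sum_(i < k) digit b n i * b ^ i)%N = n.
  elim: k => [|k IH]; first by rewrite big_ord0 expn0 divn1 muln1 addn0.
  have E : (n %/ b ^ k * b ^ k
            = n %/ b ^ k.+1 * b ^ k.+1 + digit b n k * b ^ k)%N.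
    by rewrite expnSr divnMA [(b ^ k * b)%N]mulnC mulnA -mulnDl -divn_eq.
  by rewrite big_ord_recr /= addnA addnAC -E.
have h : (n %/ b ^ n = 0)%N := divn_small (ltn_expl n b2).
by move: (H n); rewrite h mul0n add0n => ->.
Qed.

(* Used for 1 < alpha and 0 < a, where the series converges. *)
Definition hurwitz_zeta (R : realType) (alpha a : R) : R :=
  limn (series (fun n : nat => (a + n%:R) `^ (- alpha))).

(* The double series has nonnegative terms, so it is the unordered sum over
   nat * nat in [0, +oo]. It is finite when 2 < alpha, 0 < x, 0 < a.1, 0 < a.2. *)
Definition barnes_zeta2 (R : realType) (alpha x : R) (a : R * R) : R :=
  fine (\esum_(m in [set: nat * nat])
    ((x + a.1 * m.1%:R + a.2 * m.2%:R) `^ (- alpha))%:E)%E.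

(* Main.v *)
(* Write f(n) = (n + z)^(-alpha). An integer n has floor(n / b^l) representations
   n = m1 + b^l (m2 + 1), so zeta_2(alpha, z + b^l, (1, b^l)) is the sum of
   floor(n / b^l) f(n). Subtracting the value shifted by b^p leaves the terms with
   n < b^p plus b^(p - l) times the tail of f. In the combination
   "term l minus b times term l + 1" these tails cancel, and
   floor(n / b^l) - b floor(n / b^(l+1)) is the l-th digit of n. For the infinite
   sum, Legendre's formula n = s_b(n) + (b - 1) sum_(l >= 1) floor(n / b^l) is
   multiplied by f(n) and summed, exchanging the two sums by positivity; n f(n) =
   (n + z)^(1 - alpha) - z (n + z)^(-alpha) gives the Hurwitz zeta values. *)

Require Import Defs.
From HB Require Import structures.
From mathcomp Require Import all_boot all_order all_algebra.
From mathcomp Require Import all_classical all_reals all_analysis.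
From mathcomp Require Import ring zify.
Import Order.TTheory GRing.Theory Num.Theory.
Import numFieldNormedType.Exports.
Local Open Scope classical_set_scope.
Local Open Scope ring_scope.

(** * Digits and Legendre's formula *)

Lemma digit_divn (b n l : nat) :
  (n %/ b ^ l = b * (n %/ b ^ l.+1) + digit b n l)%N.
Proof. by rewrite expnSr divnMA mulnC -divn_eq. Qed.

Lemma digit_sum_widen (b n p : nat) : (2 <= b)%N -> (n < b ^ p)%N ->
  digit_sum b n = (\sum_(0 <= l < p) digit b n l)%N.
Proof.
move=> b2 np; rewrite /digit_sum -(big_mkord xpredT (digit b n)).
have big_tail m k : (m <= k)%N -> (forall i, (m <= i)%N -> digit b n i = 0%N) ->
    (\sum_(0 <= l < k) digit b n l = \sum_(0 <= l < m) digit b n l)%N.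
  move=> mk h; rewrite (@big_cat_nat _ _ _ m)//= [X in (_ + X)%N]big_nat_cond.
  by rewrite [X in (_ + X)%N]big1 ?addn0// => i; rewrite andbT => /andP[/h].
(* Both ranges are compared with the one up to [maxn n p]; the extra digits vanish because n < b^n
   on one side and n < b^p on the other. *)
rewrite -(big_tail n (maxn n p)) ?leq_maxl//; last by move=> i; exact: digit_eq0.
apply: big_tail; first exact: leq_maxr.
move=> i pi; rewrite /digit divn_small ?mod0n//.
by rewrite (leq_trans np)// leq_pexp2l// ltnW.
Qed.

(** Summing [digit_divn] over l < n leaves two floor sums that differ by a shift of l; the boundary
    terms are n at l = 0 and 0 at l = n. *)
Lemma digit_sum_legendre (b n : nat) : (2 <= b)%N ->
  (n = digit_sum b n + (b - 1) * \sum_(0 <= l < n) n %/ b ^ l.+1)%N.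
Proof.
move=> b2; rewrite (digit_sum_widen _ _ _ b2 (ltn_expl n b2)).
have H : (\sum_(0 <= l < n) n %/ b ^ l
    = b * (\sum_(0 <= l < n) n %/ b ^ l.+1) + \sum_(0 <= l < n) digit b n l)%N.
  by rewrite big_distrr -big_split/=; apply: eq_bigr => l _; exact: digit_divn.
have : (\sum_(0 <= l < n.+1) n %/ b ^ l = \sum_(0 <= l < n) n %/ b ^ l)%N.
  by rewrite big_nat_recr//= divn_small ?addn0// ltn_expl.
rewrite big_nat_recl// expn0 divn1 H.
set U := (\sum_(0 <= l < n) n %/ b ^ l.+1)%N => nU.
(* [leq_pmull] gives U <= b * U, so the truncated subtraction is exact. *)
by rewrite mulnBl mul1n; have := leq_pmull U (ltnW b2); lia.
Qed.

(** * Convergence of positive series and lattice sums *)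

Section positive_series.
Variable R : realType.
Implicit Types (alpha x z s : R) (f : nat -> R).

(** Links the two settings: sums are interchanged in the extended reals, where positivity suffices,
    and limits are taken in [R]. *)
Lemma series_lty_cvg f : (forall n, 0 <= f n) ->
  (\sum_(n <oo) (f n)%:E < +oo)%E ->
  series f @ \oo --> fine (\sum_(n <oo) (f n)%:E)%E.
Proof.
move=> f0 foo.
have E0 n : xpredT n -> (0 <= (f n)%:E)%E by rewrite lee_fin.
have S : summable xpredT (EFin \o f).
  rewrite /summable -(@nneseries_esum _ _ xpredT)//.
  by under eq_eseriesr do rewrite /= ger0_norm//.
have := summable_nneseries_lim E0 S.
rewrite /= => ->; have := summable_cvg E0 S.
exact.
Qed.

Lemma nneseries_lty f M : (forall n, 0 <= f n) -> (forall n, series f n <= M) ->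
  (\sum_(n <oo) (f n)%:E < +oo)%E.
Proof.
move=> f0 fM; apply: (@le_lt_trans _ _ M%:E); last exact: ltry.
apply: lime_le; first by apply: is_cvg_nneseries => n _ _; rewrite lee_fin.
by apply: nearW => n; rewrite sumEFin lee_fin; exact: fM.
Qed.

Lemma nneseries_fin_num f : (forall n, 0 <= f n) ->
  (\sum_(n <oo) (f n)%:E < +oo)%E -> (\sum_(n <oo) (f n)%:E)%E \is a fin_num.
Proof.
move=> f0 foo; rewrite ge0_fin_numE//.
by apply: nneseries_ge0 => n _ _; rewrite lee_fin.
Qed.

(* Condensation: the terms with 2^k <= n < 2^(k+1) add up to at most r^k, where
   r = 2^(1-s) < 1. *)
Lemma nneseries_powR_lty s : 1 < s ->
  (\sum_(n <oo) (n%:R `^ (- s))%:E < +oo :> \bar R)%E.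
Proof.
move=> s1; set r : R := 2 `^ (1 - s).
have r0 : 0 < r by rewrite powR_gt0.
have r1 : r < 1.
  rewrite -[ltRHS](@powRr0 _ 2) /r /powR.
  by rewrite !gt_eqF//= ltr_expR ltr_pM2r ?ln_gt0 ?ltr1n// subr_lt0.
apply: (@nneseries_lty _ (1 * (1 - r)^-1)) => [n|n]; first exact: powR_ge0.
have dyadic k : series (fun n => n%:R `^ (- s)) (2 ^ k)%N
    <= series (geometric 1 r) k.
  elim: k => [|k IH].
    by rewrite expn0 /series/= big_nat1 big_geq// powR0// oppr_eq0 gt_eqF// (lt_trans _ s1).
  rewrite [leRHS]seriesSr {1}/series/= (@big_cat_nat _ _ _ (2 ^ k))//=; last first.
    by rewrite leq_exp2l.
  apply: lerD => //; rewrite mul1r.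
  apply: (@le_trans _ _ (\sum_(2 ^ k <= i < 2 ^ k.+1) (2 ^ k)%:R `^ (- s))).
    apply: ler_sum_nat => i /andP[ki _]; rewrite !powRN lef_pV2 ?posrE ?powR_gt0//; last first.
      by rewrite ltr0n (leq_trans _ ki)// expn_gt0.
    by apply: ge0_ler_powR; rewrite ?nnegrE ?ler0n ?ler_nat// ltW// (lt_trans _ s1).
  rewrite sumr_const_nat expnS mul2n -addnn addnK -[leLHS]mulr_natl natrX.
  rewrite -(@powR_mulrn _ 2)// -powRrM -powRD; last by apply/implyP => _; rewrite gt_eqF.
  rewrite /r -powR_mulrn ?powR_ge0// -powRrM.
  by rewrite (_ : k%:R + _ = (1 - s) * k%:R)//; ring.
apply: le_trans (@geometric_le_lim _ n 1 r ler01 r0 _); last by rewrite gtr0_norm.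
apply: le_trans (dyadic n).
apply: (nondecreasing_series (P := xpredT)); last by rewrite ltnW// ltn_expl.
by move=> i _ _; exact: powR_ge0.
Qed.

(** For n > 0 the term is at most n^(1 - alpha), which is summable since 1 < alpha - 1. *)
Lemma nneseries_muln_powR_lty alpha z : 2 < alpha -> 0 <= z ->
  (\sum_(n <oo) (n%:R * (n%:R + z) `^ (- alpha))%:E < +oo)%E.
Proof.
move=> alpha2 z0.
have s1 : 1 < alpha - 1 by rewrite ltrBrDr.
apply: le_lt_trans (nneseries_powR_lty _ s1).
apply: lee_nneseries => [n _ _|n _]; rewrite lee_fin ?mulr_ge0 ?powR_ge0//.
have [->|n0] := posnP n; first by rewrite mul0r powR_ge0.
have nR : 0 < n%:R :> R by rewrite ltr0n.
rewrite opprB powRD; last by apply/implyP => _; rewrite gt_eqF.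
rewrite powRr1// ler_wpM2l// !powRN lef_pV2 ?posrE ?powR_gt0//; last first.
  by rewrite ltr_wpDr.
by apply: ge0_ler_powR; rewrite ?nnegrE ?lerDl ?addr_ge0// ltW// (lt_trans _ alpha2).
Qed.

(** Serves the floor weights below, which all lie between 0 and n. *)
Lemma nneseries_wt_powR_lty (w : nat -> R) alpha z : 2 < alpha -> 0 <= z ->
  (forall n, 0 <= w n <= n%:R) ->
  (\sum_(n <oo) (w n * (n%:R + z) `^ (- alpha))%:E < +oo)%E.
Proof.
move=> alpha2 z0 wn; apply: le_lt_trans (nneseries_muln_powR_lty _ _ alpha2 z0).
apply: lee_nneseries => [n _ _|n _]; have /andP[w0 ?] := wn n.
  by rewrite lee_fin mulr_ge0// powR_ge0.
by rewrite lee_fin ler_wpM2r// powR_ge0.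
Qed.

(* [n %/ d] is the number of pairs (i, j) with i + d (j + 1) = n. *)
Lemma nneseries_lattice (g : nat -> \bar R) (d : nat) : (0 < d)%N ->
  (forall n, 0 <= g n)%E ->
  (\sum_(i <oo) \sum_(j <oo) g (i + d * j.+1)%N
   = \sum_(n <oo) (n %/ d)%:R%:E * g n)%E.
Proof.
move=> d0 g0; rewrite nneseries_interchange//.
under eq_eseriesr => j _.
  by rewrite (@nneseries_addn _ g) ?ereal_series ?eseries_mkcond//; over.
rewrite nneseries_interchange; last by move=> i j; case: ifP.
apply: eq_eseriesr => n _.
rewrite (nneseries_split 0%N (n %/ d)); last by move=> k _; case: ifP.
rewrite add0n eseries0 ?adde0; last first.
  by move=> k nk _; rewrite mulnC -leq_divRL// leqNgt ltnS nk.
under eq_big_nat => i /andP[_ ind] do rewrite mulnC -leq_divRL// ind.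
by rewrite mule_natl -{2}(subn0 (n %/ d)%N); exact: sumr_const_nat.
Qed.

(** Since x + d + i + d j = (i + d (j + 1)) + x, the pair (i, j) contributes at the integer counted
    in [nneseries_lattice]. *)
Lemma barnes_zeta2E alpha x d : (0 < d)%N ->
  barnes_zeta2 alpha (x + d%:R) (1, d%:R)
  = fine (\sum_(n <oo) ((n %/ d)%:R * (n%:R + x) `^ (- alpha))%:E)%E.
Proof.
move=> d0; rewrite /barnes_zeta2; congr fine.
pose g n : \bar R := ((n%:R + x) `^ (- alpha))%:E.
have g0 n : (0 <= g n)%E by rewrite lee_fin powR_ge0.
transitivity (\sum_(i <oo) \sum_(j <oo) g (i + d * j.+1)%N)%E; last first.
  by rewrite nneseries_lattice.
rewrite nneseries_esumT; last by move=> i; apply: nneseries_ge0.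
under [RHS]eq_esum do rewrite nneseries_esumT//.
rewrite esum_esum//.
rewrite (_ : _ `*`` _ = setT); last by apply/seteqP; split.
apply: eq_esum => -[i j] _ /=; rewrite /g; congr (_ `^ _)%:E.
rewrite natrD natrM -natr1 mul1r mulrDr mulr1.
by ring.
Qed.

(** * Floor sums and the two identities *)

Section floor_sums.
Variables (b : nat) (alpha z : R).
Hypotheses (b2 : (2 <= b)%N) (alpha2 : 2 < alpha) (z0 : 0 <= z).

Let f (n : nat) : R := (n%:R + z) `^ (- alpha).

Let f_ge0 n : 0 <= f n. Proof. exact: powR_ge0. Qed.

Lemma series_wt_powR_cvg (w : nat -> R) : (forall n, 0 <= w n <= n%:R) ->
  series (fun n => w n * f n) @ \oo
    --> fine (\sum_(n <oo) (w n * f n)%:E)%E.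
Proof.
move=> wn; apply: series_lty_cvg; last exact: nneseries_wt_powR_lty.
by move=> n; have /andP[? _] := wn n; rewrite mulr_ge0.
Qed.

(** As n + M >= 1, f(n + M) is at most (n + M) f(n + M), whose sum is a tail of a convergent
    series. *)
Lemma series_shift_powR_cvg (M : nat) : (0 < M)%N ->
  series (fun n => f (n + M)) @ \oo --> fine (\sum_(n <oo) (f (n + M))%:E)%E.
Proof.
move=> M0; apply: series_lty_cvg => //.
apply: le_lt_trans (nneseries_muln_powR_lty _ _ alpha2 z0).
rewrite [leRHS](nneseries_split 0 M); last first.
  by move=> k _; rewrite lee_fin mulr_ge0 ?powR_ge0.
apply: le_trans (leeDr _ _); last first.
  by apply: sume_ge0 => i _; rewrite lee_fin mulr_ge0 ?powR_ge0.
rewrite add0n -(@nneseries_addn _ (fun k => (k%:R * f k)%:E)); last first.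
  by move=> k; rewrite lee_fin mulr_ge0 ?powR_ge0.
apply: lee_nneseries => [n _ _|n _]; rewrite lee_fin//.
by rewrite ler_peMl ?powR_ge0// ler1n addn_gt0 M0 orbT.
Qed.

Lemma floor_le (n d : nat) : 0 <= ((n %/ d)%:R : R) <= n%:R.
Proof. by rewrite ler0n ler_nat leq_div. Qed.

Lemma barnes_zeta2_cvg (d : nat) : (0 < d)%N ->
  series (fun n => (n %/ d)%:R * f n) @ \oo
    --> barnes_zeta2 alpha (z + d%:R) (1, d%:R).
Proof.
move=> d0; rewrite barnes_zeta2E//.
by apply: series_wt_powR_cvg => n; exact: floor_le.
Qed.

(** For M = q d, floor((n + M) / d) = floor(n / d) + q, so from M on the first series is the second
    one plus q times the tail of f. *)
Lemma barnes_zeta2_diff (d q : nat) : (0 < d)%N -> (0 < q)%N ->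
  barnes_zeta2 alpha (z + d%:R) (1, d%:R)
    - barnes_zeta2 alpha (z + d%:R + (q * d)%:R) (1, d%:R)
  = \sum_(0 <= n < q * d) (n %/ d)%:R * f n
    + q%:R * fine (\sum_(n <oo) (f (n + q * d))%:E)%E.
Proof.
move=> d0 q0; set M := (q * d)%N.
have M0 : (0 < M)%N by rewrite muln_gt0 q0.
have g n : f (n + M) = (n%:R + (z + M%:R)) `^ (- alpha).
  by rewrite /f natrD -addrA [M%:R + z]addrC.
have zM0 : 0 <= z + M%:R by rewrite addr_ge0.
(* With the subtracted value moved across, both sides are limits of the partial sums up to N + M. *)
apply/eqP; rewrite subr_eq addrAC -addrA; apply/eqP.
have := barnes_zeta2_cvg d d0; rewrite -(cvg_shiftn M).
move=> /cvg_unique; apply => //.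
rewrite (_ : (fun _ => _) = (fun N => \sum_(0 <= n < M) (n %/ d)%:R * f n
   + (series (fun n => (n %/ d)%:R * (n%:R + (z + M%:R)) `^ (- alpha)) N
      + q%:R * series (fun n => f (n + M)) N))); last first.
  apply/funext => N; rewrite /series/= (@big_cat_nat _ _ _ M)//= ?leq_addl//.
  rewrite -{2}(add0n M) big_addn addnK; congr (_ + _).
  rewrite big_distrr -big_split/=; apply: eq_bigr => n _.
  by rewrite -g (addnC n M) divnMDl// natrD mulrDl addrC.
apply: cvgD; first exact: cvg_cst.
apply: cvgD; last by apply: cvgMr; exact: series_shift_powR_cvg.
rewrite addrAC barnes_zeta2E//; apply: series_lty_cvg.
  by move=> n; rewrite mulr_ge0 ?powR_ge0.
by apply: nneseries_wt_powR_lty => // n; exact: floor_le.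
Qed.

(** Equals the sum of floor(n / b^l) over all l >= 1, as b^l > n for l > n; for b prime, the
    exponent of b in n!. *)
Let u (n : nat) : nat := (\sum_(0 <= l < n) n %/ b ^ l.+1)%N.

(** Legendre's formula gives (b - 1) u(n) <= n, and b - 1 >= 1. *)
Let u_le n : 0 <= ((u n)%:R : R) <= n%:R.
Proof.
have nE : n = (digit_sum b n + (b - 1) * u n)%N by exact: digit_sum_legendre.
by rewrite ler0n ler_nat [leqRHS]nE (leq_trans _ (leq_addl _ _))// leq_pmull// subn_gt0.
Qed.

Lemma nneseries_floor_pow (n : nat) :
  (\sum_(l <oo) ((n %/ b ^ l.+1)%:R * f n)%:E = ((u n)%:R * f n)%:E)%E.
Proof.
rewrite (nneseries_split 0 n); last by move=> k _; rewrite lee_fin mulr_ge0.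
rewrite add0n eseries0 ?adde0; last first.
  move=> l nl _; rewrite divn_small ?mul0r//.
  by rewrite (leq_ltn_trans (leqW nl))// ltn_expl.
by rewrite sumEFin /u natr_sum mulr_suml.
Qed.

(** The sums over l and n are exchanged by positivity; the result is finite because u(n) <= n. *)
Lemma sum_barnes_zeta2_cvg :
  (fun N => \sum_(1 <= l < N) barnes_zeta2 alpha (z + b%:R ^+ l) (1, b%:R ^+ l))
  @ \oo --> fine (\sum_(n <oo) ((u n)%:R * f n)%:E)%E.
Proof.
have b0 l : (0 < b ^ l)%N by rewrite expn_gt0 ltnW.
have fl l n : (0 <= ((n %/ b ^ l)%:R * f n)%:E)%E by rewrite lee_fin mulr_ge0.
pose B l := barnes_zeta2 alpha (z + b%:R ^+ l) (1, b%:R ^+ l).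
have BE l : B l = fine (\sum_(n <oo) ((n %/ b ^ l)%:R * f n)%:E)%E.
  by rewrite /B -natrX barnes_zeta2E.
have EB l : (B l)%:E = (\sum_(n <oo) ((n %/ b ^ l)%:R * f n)%:E)%E.
  rewrite BE fineK//; apply: nneseries_fin_num => [n|]; first exact: mulr_ge0.
  by apply: nneseries_wt_powR_lty => // n; exact: floor_le.
have B0 l : 0 <= B l by rewrite -lee_fin EB; apply: nneseries_ge0.
rewrite -cvg_shiftS.
rewrite (_ : [sequence _]_n = series (fun l => B l.+1)); last first.
  by apply/funext => N; rewrite /series/= big_add1.
have -> : (\sum_(n <oo) ((u n)%:R * f n)%:E = \sum_(l <oo) (B l.+1)%:E)%E.
  under eq_eseriesr do rewrite -nneseries_floor_pow.
  rewrite nneseries_interchange; last by move=> *; exact: fl.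
  by apply: eq_eseriesr => l _; rewrite EB.
apply: series_lty_cvg => //.
under eq_eseriesr do rewrite EB.
rewrite nneseries_interchange; last by move=> *; exact: fl.
under eq_eseriesr do rewrite nneseries_floor_pow.
by apply: nneseries_wt_powR_lty => // n; exact: u_le.
Qed.

(** Rests on (n + 1 + z)^(1 - alpha) = (n + 1) f(n + 1) + z f(n + 1), summed over n. *)
Lemma muln_powR_hurwitz_zeta :
  series (fun n => n%:R * f n) @ \oo
    --> - z * hurwitz_zeta alpha (z + 1) + hurwitz_zeta (alpha - 1) (z + 1).
Proof.
have fS : (fun n : nat => (z + 1 + n%:R) `^ (- alpha)) = (fun n => f (n + 1)).
  by apply/funext => n; rewrite /f natrD; congr (_ `^ _); ring.
have := series_shift_powR_cvg 1 isT; rewrite -fS; set H := fine _ => cH.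
have HE : hurwitz_zeta alpha (z + 1) = H by exact: cvg_lim cH.
have : series (fun n => n%:R * f n) @ \oo
    --> fine (\sum_(n <oo) (n%:R * f n)%:E)%E.
  by apply: series_wt_powR_cvg => n; rewrite ler0n lexx.
set L := fine _ => cL.
suff -> : hurwitz_zeta (alpha - 1) (z + 1) = L + z * H.
  by rewrite HE mulNr addrCA addNr addr0.
apply: cvg_lim => //.
(* The upper bound [N.+1] absorbs the index shift: the term n = 0 has weight 0. *)
rewrite (_ : series _ = (fun N => series (fun n => n%:R * f n) N.+1
  + z * series (fun n => (z + 1 + n%:R) `^ (- alpha)) N)); last first.
  apply/funext => N; rewrite /series/= big_nat_recl// mul0r add0r.
  rewrite big_distrr -big_split/=; apply: eq_bigr => n _.
  have -> : z + 1 + n%:R = n.+1%:R + z by rewrite -natr1; ring.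
  rewrite -mulrDl opprB powRD; last first.
    by apply/implyP => _; rewrite gt_eqF// ltr_wpDr.
  by rewrite powRr1// addr_ge0.
apply: cvgD; last exact: cvgMr.
by rewrite (cvg_shiftS (series (fun n => n%:R * f n))).
Qed.

(** Termwise, s_b(n) = n + (1 - b) u(n), and both weighted series converge. *)
Lemma digit_sum_cvg :
  (fun N : nat => \sum_(1 <= n < N) (digit_sum b n)%:R / (n%:R + z) `^ alpha)
    @ \oo -->
    - z * hurwitz_zeta alpha (z + 1) + hurwitz_zeta (alpha - 1) (z + 1)
    + (1 - b%:R) *
      limn (fun N : nat =>
        \sum_(1 <= l < N) barnes_zeta2 alpha (z + b%:R ^+ l) (1, b%:R ^+ l)).
Proof.
have -> := cvg_lim (@Rhausdorff R) sum_barnes_zeta2_cvg.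
rewrite (_ : (fun _ => _) = (fun N => series (fun n => n%:R * f n) N
  + (1 - b%:R) * series (fun n => (u n)%:R * f n) N)); last first.
  apply/funext => -[|N]; first by rewrite /series/= !big_geq// mulr0 addr0.
  rewrite /series/= big_distrr -big_split/= [RHS]big_nat_recl// mul0r.
  rewrite (_ : u 0 = 0%N); last by rewrite /u big_geq.
  rewrite !(mul0r, mulr0, add0r) big_add1/=; apply: eq_bigr => n _.
  have nE : n.+1%:R = (digit_sum b n.+1)%:R + (b%:R - 1) * (u n.+1)%:R :> R.
    by rewrite {1}(digit_sum_legendre b n.+1 b2) natrD natrM natrB// ltnW.
  by rewrite -powRN -/(f n.+1) nE; ring.
apply: cvgD; first exact: muln_powR_hurwitz_zeta.
by apply: cvgMr; apply: series_wt_powR_cvg => n; exact: u_le.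
Qed.

Lemma digit_sum_barnes_zeta2 (p : nat) :
  \sum_(1 <= n < b ^ p) (digit_sum b n)%:R / (n%:R + z) `^ alpha =
    \sum_(0 <= l < p)
      (barnes_zeta2 alpha (z + b%:R ^+ l) (1, b%:R ^+ l)
       - barnes_zeta2 alpha (z + b%:R ^+ l + b%:R ^+ p) (1, b%:R ^+ l))
    - b%:R * \sum_(1 <= l < p.+1)
      (barnes_zeta2 alpha (z + b%:R ^+ l) (1, b%:R ^+ l)
       - barnes_zeta2 alpha (z + b%:R ^+ l + b%:R ^+ p) (1, b%:R ^+ l)).
Proof.
set T := fine (\sum_(n <oo) (f (n + b ^ p))%:E)%E.
(* Taking q = b^(p - l) and d = b^l gives q d = b^p, so the tail [T] is the same for every l. *)
have DE l : (l <= p)%N ->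
  barnes_zeta2 alpha (z + b%:R ^+ l) (1, b%:R ^+ l)
  - barnes_zeta2 alpha (z + b%:R ^+ l + b%:R ^+ p) (1, b%:R ^+ l)
  = \sum_(0 <= n < b ^ p) (n %/ b ^ l)%:R * f n + (b ^ (p - l))%:R * T.
  move=> lp; have pE : (b ^ p = b ^ (p - l) * b ^ l)%N by rewrite -expnD subnK.
  rewrite -!natrX /T pE; apply: barnes_zeta2_diff;
    by rewrite expn_gt0 ltnW.
rewrite [X in b%:R * X]big_add1/= big_distrr -sumrB/=.
transitivity (\sum_(0 <= l < p) \sum_(0 <= n < b ^ p) (digit b n l)%:R * f n).
  rewrite exchange_big/= [RHS]big_ltn ?expn_gt0 ?(ltnW b2)// [X in X + _]big1 ?add0r.
    apply: eq_big_nat => n /andP[_ np].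
    by rewrite -mulr_suml -powRN (digit_sum_widen _ _ _ b2 np) natr_sum.
  by move=> l _; rewrite /digit div0n mod0n mul0r.
apply: eq_big_nat => l /andP[_ lp]; rewrite (DE _ (ltnW lp)) (DE _ lp).
(* The tails cancel: b^(p - l) = b * b^(p - (l + 1)). *)
rewrite -(subnSK lp) expnS natrM mulrDr mulrA.
rewrite opprD addrACA subrr addr0 big_distrr -sumrB/=.
apply: eq_bigr => n _.
by rewrite (digit_divn b n l) natrD natrM; ring.
Qed.

End floor_sums.
End positive_series.

(* MathComp-Analysis *)
Theorem theorem29 (R : realType) (b p : nat) (alpha z : R)
    (hb : (2 <= b)%N) (hp : (1 <= p)%N) (halpha : 2 < alpha) (hz : 0 <= z) :
  \sum_(1 <= n < b ^ p) (digit_sum b n)%:R / (n%:R + z) `^ alpha =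
    \sum_(0 <= l < p)
      (barnes_zeta2 alpha (z + b%:R ^+ l) (1, b%:R ^+ l)
       - barnes_zeta2 alpha (z + b%:R ^+ l + b%:R ^+ p) (1, b%:R ^+ l))
    - b%:R * \sum_(1 <= l < p.+1)
      (barnes_zeta2 alpha (z + b%:R ^+ l) (1, b%:R ^+ l)
       - barnes_zeta2 alpha (z + b%:R ^+ l + b%:R ^+ p) (1, b%:R ^+ l))
  /\
  cvgn (fun N : nat =>
    \sum_(1 <= l < N) barnes_zeta2 alpha (z + b%:R ^+ l) (1, b%:R ^+ l))
  /\
  (fun N : nat => \sum_(1 <= n < N) (digit_sum b n)%:R / (n%:R + z) `^ alpha)
    @ \oo -->
    - z * hurwitz_zeta alpha (z + 1) + hurwitz_zeta (alpha - 1) (z + 1)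
    + (1 - b%:R) *
      limn (fun N : nat =>
        \sum_(1 <= l < N) barnes_zeta2 alpha (z + b%:R ^+ l) (1, b%:R ^+ l)).
Proof.
split; first exact: digit_sum_barnes_zeta2.
split; last exact: digit_sum_cvg.
by apply: cvgP; exact: sum_barnes_zeta2_cvg.
Qed.
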